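(* Let $\alpha\in A$ be an umbra with generating function $f(\alpha,t)$ and let $\boldsymbol{\mu}=(\mu_1,\ldots,\mu_n)$ be an $n$-tuple of umbral monomials with generating function $f(\boldsymbol{\mu},\boldsymbol{t})$, $\boldsymbol{t}=(t_1,\ldots,t_n)$. Then the auxiliary umbra $\alpha\boldsymbol{.}\beta\boldsymbol{.}\boldsymbol{\mu}$ has generating function $$f(\alpha\boldsymbol{.}\beta\boldsymbol{.}\boldsymbol{\mu},\boldsymbol{t})=f[\alpha,\,f(\boldsymbol{\mu},\boldsymbol{t})-1],$$ an identity of formal power series in $t_1,\dots,t_n$.
   Context: $R$ is the real or complex field, $A$ is a set (the alphabet) whose elements are called umbrae, and $E:R[A]\to R$ is a linear functional (evaluation) with $E[1]=1$ and $E[\alpha^i\gamma^j\cdots]=E[\alpha^i]E[\gamma^j]\cdots$ for distinct umbrae and nonnegative integers $i,j,\dots$. The moments of $\alpha\in A$ are $a_k=E[\alpha^k]$, and its generating function is $f(\alpha,t)=1+\sum_{k\ge1}a_k t^k/k!$. For formal power series $s$ without constant term, $f[\alpha,s]=1+\sum_{k\ge 1}a_k s^k/k!$. An $n$-tuple $\boldsymbol{\mu}=(\mu_1,\dots,\mu_n)$ of umbral monomials (monomials in $R[A]$, supports not necessarily disjoint) has multivariate moments $g_{\boldsymbol{i}}=E[\boldsymbol{\mu}^{\boldsymbol{i}}]$, $\boldsymbol{\mu}^{\boldsymbol{i}}=\mu_1^{i_1}\cdots\mu_n^{i_n}$, $\boldsymbol{i}\in\mathbb{N}_0^n$ (so $g_{\boldsymbol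 0}=1$), and generating function $f(\boldsymbol{\mu},\boldsymbol{t})=1+\sum_{\boldsymbol{i}\neq\boldsymbol{0}}g_{\boldsymbol{i}}\,\boldsymbol{t}^{\boldsymbol{i}}/\boldsymbol{i}!$ with $\boldsymbol{i}!=i_1!\cdots i_n!$ and $\boldsymbol{t}^{\boldsymbol{i}}=t_1^{i_1}\cdots t_n^{i_n}$. Partitions of a multi-index: a partition $\boldsymbol{\lambda}$ of $\boldsymbol{i}\in\mathbb{N}_0^n$, written $\boldsymbol{\lambda}\vdash\boldsymbol{i}$, is a matrix of nonnegative integers with $n$ rows, no zero column, columns in lexicographic order, and $r$-th row sum equal to $i_r$ for $r=1,\dots,n$. Its number of columns is $l(\boldsymbol{\lambda})$. Writing $\boldsymbol{\lambda}=(\boldsymbol{\lambda}_1^{r_1},\boldsymbol{\lambda}_2^{r_2},\dots)$ when the distinct column $\boldsymbol{\lambda}_j$ occurs $r_j$ times, set $\mathfrak{m}(\boldsymbol{\lambda})!=r_1!r_2!\cdots$ and $\boldsymbol{\lambda}!=\prod_j(\boldsymbol{\lambda}_j!)^{r_j}$ (product of factorials of all entries). Set $g_{\boldsymbol{\lambda}}=g_{\boldsymbol{\lambda}_1}^{r_1}g_{\boldsymbol{\lambda}_2}^{r_2}\cdots$. The auxiliary umbra $\alpha\boldsymbol{.}\beta\boldsymbol{.}\boldsymbol{\mu}$ ($\beta$ denotes the Bell umbra) is the symbolic $n$-tuple defined by its moments: $$E[(\alpha\boldsymbol{.}\beta\boldsymbol{.}\boldsymbol{\mu})^{\boldsymbol{i}}]=\sum_{\boldsymbol{\lambda}\vdash\boldsymbol{i}}\frac{\boldsymbol{i}!}{\mathfrak{m}(\boldsymbol{\lambda})!\,\boldsymbol{\lambda}!}\,a_{l(\boldsymbol{\lambda})}\,g_{\boldsymbol{\lambda}},\qquad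 \boldsymbol{i}\in\mathbb{N}_0^n,$$ and its generating function is $f(\alpha\boldsymbol{.}\beta\boldsymbol{.}\boldsymbol{\mu},\boldsymbol{t})=1+\sum_{\boldsymbol{i}\ne\boldsymbol{0}}E[(\alpha\boldsymbol{.}\beta\boldsymbol{.}\boldsymbol{\mu})^{\boldsymbol{i}}]\,\boldsymbol{t}^{\boldsymbol{i}}/\boldsymbol{i}!$. *)

(* Defs.v *)
From HB Require Import structures.
From mathcomp Require Import all_boot all_order all_algebra.
From mathcomp Require Import reals complex monalg.

Set Implicit Arguments.
Unset Strict Implicit.
Unset Printing Implicit Defensive.

Import Order.TTheory GRing.Theory Num.Theory.
Local Open Scope ring_scope.

Variant real_or_complex (F : realType) : numFieldType -> Prop :=
  | IsReal : real_or_complex F (F : numFieldType)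
  | IsComplex : real_or_complex F (F[i]%C : numFieldType).

(* The polynomial ring R[A] over a possibly infinite alphabet A; {cmonom A} is
   the type of (commutative) monomials in the elements of A, and << m >> is the
   monomial m seen as an element of R[A]. *)
Definition umbral_poly (K : numFieldType) (A : choiceType) :=
  {malg K[{cmonom A}]}.

Definition monom (K : numFieldType) (A : choiceType) (m : {cmonom A}) :
  umbral_poly K A := << m >>.

Definition umbra (K : numFieldType) (A : choiceType) (a : A) :
  umbral_poly K A := monom K (ucm a).

Definition umbral_evaluation (K : numFieldType) (A : choiceType)
    (E : {scalar umbral_poly K A}) : Prop :=
  E 1 = 1 /\
  forall (s : seq A) (e : A -> nat), uniq s ->
    E (\prod_(a <- s) umbra K a ^+ e a) = \prod_(a <- s) E (umbra K a ^+ e a).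

(* Multi-indices in N^n are column vectors 'cV[nat]_n, so that the columns of a
   partition (an n-row matrix) are multi-indices. *)
Definition mi_deg n (i : 'cV[nat]_n) : nat := (\sum_(r < n) i r ord0)%N.

Definition mi_fact n (i : 'cV[nat]_n) : nat := (\prod_(r < n) (i r ord0)`!)%N.

(* Matrices with entries bounded by d form a finite type; this embeds them in
   the matrices of natural numbers. *)
Definition natmx d m n (M : 'M['I_d]_(m, n)) : 'M[nat]_(m, n) :=
  map_mx (@nat_of_ord d) M.

Definition columns n l (L : 'M[nat]_(n, l)) : seq 'cV[nat]_n :=
  [seq col j L | j <- enum 'I_l].

Definition lexcol n (u v : 'cV[nat]_n) : bool :=
  (([seq u r ord0 | r <- enum 'I_n] : seqlexi nat)
     <= ([seq v r ord0 | r <- enum 'I_n] : seqlexi nat))%O.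

Definition is_mpartition n (i : 'cV[nat]_n) l (L : 'M[nat]_(n, l)) : bool :=
  [&& [forall j, col j L != 0],
      sorted (@lexcol n) (columns L)
    & [forall r, (\sum_(j < l) L r j)%N == i r ord0]].

Definition mult_fact n l (L : 'M[nat]_(n, l)) : nat :=
  (\prod_(c <- undup (columns L)) (count_mem c (columns L))`!)%N.

Definition mpart_fact n l (L : 'M[nat]_(n, l)) : nat :=
  (\prod_(c <- undup (columns L)) mi_fact c ^ count_mem c (columns L))%N.

Definition mpart_prod (K : numFieldType) n (g : 'cV[nat]_n -> K)
    l (L : 'M[nat]_(n, l)) : K :=
  \prod_(c <- undup (columns L)) g c ^+ count_mem c (columns L).

(* [mpartition_bound] below shows that bounding the number of columns and the
   entries of L by mi_deg i loses no partition of i. *)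
Definition mpart_sum (K : numFieldType) n (i : 'cV[nat]_n)
    (T : forall l, 'M[nat]_(n, l) -> K) : K :=
  \sum_(l < (mi_deg i).+1)
    \sum_(L : 'M['I_(mi_deg i).+1]_(n, l) | is_mpartition i (natmx L))
      T l (natmx L).

Lemma mpartition_bound n (i : 'cV[nat]_n) l (L : 'M[nat]_(n, l)) :
  is_mpartition i L ->
  (l <= mi_deg i)%N /\ (forall r j, (L r j <= mi_deg i)%N).
Proof.
move=> /and3P[/forallP nz _ /forallP rs].
have dE : mi_deg i = (\sum_(j < l) \sum_(r < n) L r j)%N.
  rewrite exchange_big /mi_deg; apply: eq_bigr => r _ /=.
  by rewrite (eqP (rs r)).
split; last first.
  move=> r j; rewrite dE (bigD1 j) //= (bigD1 r) //= -addnA; exact: leq_addr.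
rewrite dE -{1}(card_ord l) -sum1_card; apply: leq_sum => j _.
rewrite lt0n; apply: contra (nz j); rewrite sum_nat_eq0 => /forallP h.
by apply/eqP/matrixP => r k; rewrite !mxE; apply/eqP; exact: (h r).
Qed.

(* Formal power series in t_1, ..., t_n, given by their coefficients; note that
   the product is the Cauchy product, not the pointwise one. *)
Definition mfps (K : numFieldType) n := 'cV[nat]_n -> K.

Definition mfps_one (K : numFieldType) n : mfps K n := fun i => (i == 0)%:R.

Arguments mfps_one : clear implicits.

Definition mfps_sub (K : numFieldType) n (f g : mfps K n) : mfps K n :=
  fun i => f i - g i.

Definition mfps_mul (K : numFieldType) n (f g : mfps K n) : mfps K n :=
  fun i => \sum_(j : 'cV['I_(mi_deg i).+1]_n)
             \sum_(k : 'cV['I_(mi_deg i).+1]_n | natmx j + natmx k == i)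
               f (natmx j) * g (natmx k).

Definition mfps_exp (K : numFieldType) n (f : mfps K n) (k : nat) : mfps K n :=
  iter k (mfps_mul f) (mfps_one K n).

(* 1 + sum_(i != 0) g_i t^i / i! *)
Definition mfps_egf (K : numFieldType) n (g : 'cV[nat]_n -> K) : mfps K n :=
  fun i => if i == 0 then 1 else g i / (mi_fact i)%:R.

(* 1 + sum_(k >= 1) a_k s^k / k!, for s without constant term: then the
   coefficient of t^i in s^k vanishes for k > mi_deg i, so the sum may be stopped
   at mi_deg i (see [egf_subst_trunc] below). *)
Definition egf_subst (K : numFieldType) n (a : nat -> K) (s : mfps K n) :
  mfps K n :=
  fun i => mfps_one K n i +
           \sum_(1 <= k < (mi_deg i).+1) a k * mfps_exp s k i / (k`!)%:R.

Lemma mi_degD n (i j : 'cV[nat]_n) : mi_deg (i + j) = (mi_deg i + mi_deg j)%N.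
Proof. by rewrite /mi_deg -big_split; apply: eq_bigr => r _; rewrite mxE. Qed.

Lemma mi_deg_eq0 n (i : 'cV[nat]_n) : mi_deg i = 0%N -> i = 0.
Proof.
move/eqP; rewrite sum_nat_eq0 => /forallP h.
by apply/matrixP => r k; rewrite mxE ord1; apply/eqP; exact: (h r).
Qed.

Lemma mfps_exp_eq0 (K : numFieldType) n (s : mfps K n) k i :
  s 0 = 0 -> (mi_deg i < k)%N -> mfps_exp s k i = 0.
Proof.
move=> s0; elim: k i => // k IHk i lt_ik.
rewrite /mfps_exp iterS -/(mfps_exp s k) /mfps_mul.
rewrite big1 // => j _; rewrite big1 // => j' /eqP ij.
have [/mi_deg_eq0 ->|nz] := eqVneq (mi_deg (natmx j)) 0%N; first by rewrite s0 mul0r.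
rewrite IHk ?mulr0 // -ltnS (leq_trans _ lt_ik) // ltnS -{2}ij mi_degD.
by rewrite -[X in (X < _)%N]add0n ltn_add2r lt0n.
Qed.

Lemma egf_subst_trunc (K : numFieldType) n (a : nat -> K) (s : mfps K n) i N :
  s 0 = 0 -> (mi_deg i <= N)%N ->
  egf_subst a s i =
    mfps_one K n i + \sum_(1 <= k < N.+1) a k * mfps_exp s k i / (k`!)%:R.
Proof.
move=> s0 leN; congr (_ + _).
rewrite [RHS](@big_cat_nat _ _ _ (mi_deg i).+1) //= [X in _ + X]big_nat_cond.
rewrite [X in _ + X]big1 ?addr0 // => k /andP[/andP[ltk _] _].
by rewrite mfps_exp_eq0 // mulr0 mul0r.
Qed.

Definition moment (K : numFieldType) (A : choiceType)
    (E : {scalar umbral_poly K A}) (alpha : A) (k : nat) : K :=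
  E (umbra K alpha ^+ k).

Definition mmoment (K : numFieldType) (A : choiceType)
    (E : {scalar umbral_poly K A}) n (mu : n.-tuple {cmonom A})
    (i : 'cV[nat]_n) : K :=
  E (\prod_(r < n) monom K (tnth mu r) ^+ i r ord0).

Definition aux_moment (K : numFieldType) (A : choiceType)
    (E : {scalar umbral_poly K A}) (alpha : A) n (mu : n.-tuple {cmonom A})
    (i : 'cV[nat]_n) : K :=
  mpart_sum i (fun l L =>
    (mi_fact i)%:R / ((mult_fact L)%:R * (mpart_fact L)%:R)
      * moment E alpha l * mpart_prod (mmoment E mu) L).

Definition gf (K : numFieldType) (A : choiceType)
    (E : {scalar umbral_poly K A}) n (mu : n.-tuple {cmonom A}) : mfps K n :=
  mfps_egf (mmoment E mu).

Definition gf_aux (K : numFieldType) (A : choiceType)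
    (E : {scalar umbral_poly K A}) (alpha : A) n (mu : n.-tuple {cmonom A}) :
  mfps K n :=
  mfps_egf (aux_moment E alpha mu).

Definition gf_subst (K : numFieldType) (A : choiceType)
    (E : {scalar umbral_poly K A}) (alpha : A) n (s : mfps K n) : mfps K n :=
  egf_subst (moment E alpha) s.

(* Main.v *)
(* Write s = f(mu, t) - 1.  The coefficient of t^i in s^l is the sum, over all
   l-tuples of nonzero multi-indices with sum i, of the product of the
   coefficients of s.  Both the constraint and the product are invariant under
   permutation, so the tuples may be grouped by their lexicographically sorted
   rearrangement, which is a partition lambda of i with l columns; it arises from
   l! / m(lambda)! tuples.  The factor l! cancels the one in a_l s^l / l!. *)

Require Import Defs.
From mathcomp Require Import all_boot all_order all_algebra.
From mathcomp Require Import reals monalg ring.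

Set Implicit Arguments.
Unset Strict Implicit.
Unset Printing Implicit Defensive.

Import GRing.Theory Num.Theory.
Local Open Scope ring_scope.

(** * Counting the rearrangements of a sequence *)

Lemma prod_fact_count_undup (T : eqType) (s r : seq T) :
  uniq r -> {subset s <= r} ->
  (\prod_(c <- undup s) (count_mem c s)`! = \prod_(c <- r) (count_mem c s)`!)%N.
Proof.
move=> Ur sub_sr; rewrite [RHS](bigID (mem s)) /= [X in (_ * X)%N]big1 ?muln1.
  rewrite -[RHS]big_filter; apply: perm_big; apply: uniq_perm.
  - exact: undup_uniq.
  - exact: filter_uniq.
  - move=> c; rewrite mem_undup mem_filter /=.
    by case: (boolP (c \in s)) => //= /sub_sr ->.
by move=> c /count_memPn ->.
Qed.

Lemma sum_count_undup (T : eqType) (s : seq T) :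
  (\sum_(c <- undup s) count_mem c s = size s)%N.
Proof.
rewrite -sum1_size -[RHS]big_undup_iterop_count; apply: eq_bigr => c _.
by rewrite Monoid.iteropE iter_addn_0 mul1n.
Qed.

(** Induction on the length, by first letter: the rearrangements of [s] that start with [x] are [x]
    followed by those of [rem x s]. *)
Lemma size_permutations_multinomial (T : eqType) (s : seq T) :
  (size (permutations s) * \prod_(c <- undup s) (count_mem c s)`! = (size s)`!)%N.
Proof.
have [n] := ubnP (size s); elim: n s => // n IHn s lt_sn.
case: (posnP (size s)) => [/size0nil -> | s_gt0].
  by rewrite big_nil.
rewrite (perm_size (permutationsE s_gt0)) size_allpairs_dep sumnE big_map.
rewrite big_distrl /=.
transitivity (\sum_(x <- undup s) count_mem x s * (size s).-1`!)%N; last first.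
  by rewrite -big_distrl /= sum_count_undup -[in RHS](prednK s_gt0) factS prednK.
rewrite big_seq [RHS]big_seq; apply: eq_bigr => x; rewrite mem_undup => s_x.
rewrite -(size_rem s_x) -IHn; last by rewrite size_rem // prednK.
rewrite mulnCA; congr (_ * _)%N.
have Us := undup_uniq s.
(* [x] may be gone from [rem x s]; indexing by [undup s] then only adds a factor 0! = 1, and the two
   products can be compared letter by letter. *)
rewrite (@prod_fact_count_undup _ (rem x s) (undup s)) //; last first.
  by move=> y /mem_rem; rewrite mem_undup.
have u_x : x \in undup s by rewrite mem_undup.
rewrite !(bigD1_seq x u_x Us) /= mulnA; congr (_ * _)%N.
  rewrite count_mem_rem eqxx subn1.
  have: (0 < count_mem x s)%N by rewrite -has_count has_pred1.
  by case: (count_mem x s).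
by apply: eq_bigr => c ncx; rewrite count_mem_rem eq_sym (negPf ncx) subn0.
Qed.

(** * Sums over tuples, grouped by sorting or by first entry *)

Lemma card_perm_eq_tuple (T : finType) l (u : l.-tuple T) :
  #|[pred t : l.-tuple T | perm_eq t u]| = size (permutations u).
Proof.
rewrite cardE -(size_map val); apply/perm_size/uniq_perm.
- by rewrite (map_inj_uniq val_inj) enum_uniq.
- exact: permutations_uniq.
move=> s; rewrite mem_permutations; apply/mapP/idP => [[t + ->]|pus].
  by rewrite mem_enum.
have sz : size s == l by rewrite (perm_size pus) size_tuple.
by exists (Tuple sz); rewrite ?mem_enum.
Qed.

(** Sorting splits the tuples into classes on which [P] and [Phi] are constant; each class has one
    sorted member and consists of its rearrangements. *)
Lemma sum_sorted_tuple (V : nmodType) (T : finType) (leT : rel T) l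
    (P : pred (seq T)) (Phi : seq T -> V) :
    total leT -> transitive leT -> antisymmetric leT ->
    (forall s t, perm_eq s t -> P s = P t) ->
    (forall s t, perm_eq s t -> Phi s = Phi t) ->
  \sum_(t : l.-tuple T | P t) Phi t =
  \sum_(t : l.-tuple T | sorted leT t && P t) Phi t *+ size (permutations t).
Proof.
move=> leTot leTr leA symP symPhi.
rewrite (partition_big (fun t => sort_tuple leT t)
           (fun t => sorted leT t && P t)) /=; last first.
  move=> t Pt; rewrite sort_sorted //=; rewrite (symP _ t) //.
  by rewrite perm_sort.
apply: eq_bigr => u /andP[so_u Pu]; rewrite -card_perm_eq_tuple -sumr_const.
have sortE t : (sort_tuple leT t == u) = perm_eq t u.
  rewrite -val_eqE /= -{1}(sorted_sort leTr so_u).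
  by apply/eqP/idP => [/perm_sortP->|/perm_sortP->].
apply: eq_big => [t | t /andP[_]]; rewrite ?sortE ?inE.
  by case: (boolP (perm_eq t u)) => [/symP -> | _]; rewrite ?andbF ?Pu.
by move/symPhi.
Qed.

Lemma sum_tupleS (V : nmodType) (T : finType) l (P : pred (seq T))
    (Phi : seq T -> V) :
  \sum_(t : l.+1.-tuple T | P t) Phi t =
  \sum_(x : T) \sum_(t : l.-tuple T | P (x :: t)) Phi (x :: t).
Proof.
rewrite pair_big_dep /=.
rewrite (reindex (fun p : T * l.-tuple T => [tuple of p.1 :: p.2])) //=.
exists (fun t => (thead t, [tuple of behead t])) => [[x t] _ | t _] /=.
  by congr (_, _); apply: val_inj.
by rewrite -tuple_eta.
Qed.

(** * Changing the bound on matrix entries *)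

Lemma natmx_inj d m n : injective (@natmx d m n).
Proof.
move=> M N /matrixP eqMN; apply/matrixP => i j; apply: val_inj.
by have := eqMN i j; rewrite !mxE.
Qed.

Lemma natmx_inord d m n (M : 'M[nat]_(m, n)) :
  (forall i j, M i j <= d)%N -> natmx (map_mx (@inord d) M) = M.
Proof.
by move=> leMd; apply/matrixP => i j; rewrite !mxE inordK // ltnS.
Qed.

Lemma mi_deg_ge n (i : 'cV[nat]_n) r k : (i r k <= mi_deg i)%N.
Proof. by rewrite ord1 /mi_deg (bigD1 r) //= leq_addr. Qed.

(** Matrices with an entry above [d] contribute zero; on the others, re-encoding by [inord] loses
    nothing. *)
Lemma sum_natmx (V : nmodType) d D m n (F : 'M[nat]_(m, n) -> V) :
    (d <= D)%N ->
    (forall M, F M != 0 -> forall i j, (M i j <= d)%N) ->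
  \sum_(M : 'M['I_d.+1]_(m, n)) F (natmx M) =
  \sum_(M : 'M['I_D.+1]_(m, n)) F (natmx M).
Proof.
move=> le_dD Fd.
rewrite [RHS](bigID (fun M => [forall i, forall j, (natmx M i j <= d)%N])) /=.
rewrite [X in _ + X]big1 ?addr0; last first.
  move=> M; apply: contraNeq => /Fd leMd.
  by apply/forallP => i; apply/forallP => j.
have wE (M : 'M['I_d.+1]_(m, n)) : natmx (map_mx (@inord D) (natmx M)) = natmx M.
  by apply: natmx_inord => i j; rewrite mxE -ltnS (leq_trans (ltn_ord _)).
rewrite (reindex (fun M : 'M['I_d.+1]_(m, n) => map_mx (@inord D) (natmx M))) /=.
  apply: eq_big => [M | M _]; rewrite wE //.
  by apply/esym/forallP => i; apply/forallP => j; rewrite mxE -ltnS.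
exists (fun M : 'M['I_D.+1]_(m, n) => map_mx (@inord d) (natmx M)) => [M _ | M].
  by rewrite wE; apply/natmx_inj/natmx_inord => i j; rewrite mxE -ltnS.
rewrite inE => /forallP leMd; apply: natmx_inj.
have leM i j : (natmx M i j <= d)%N by have /forallP := leMd i.
by rewrite !natmx_inord // => i j; apply: leq_trans le_dD.
Qed.

(** * Powers of a series as sums over tuples *)

(** The index bound in [mfps_mul] varies with the coefficient; a common [D] lets all powers be
    expanded over tuples of one finite type. *)
Lemma mfps_mul_bound (K : numFieldType) n (f g : mfps K n) i D :
  (mi_deg i <= D)%N ->
  mfps_mul f g i =
    \sum_(j : 'cV['I_D.+1]_n) \sum_(k : 'cV['I_D.+1]_n | natmx j + natmx k == i)
      f (natmx j) * g (natmx k).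
Proof.
move=> le_iD; rewrite /mfps_mul.
have bnd j k : j + k = i -> forall r c, (j r c <= mi_deg i)%N.
  move=> <- r c; rewrite mi_degD (leq_trans (mi_deg_ge j r c)) //.
  exact: leq_addr.
(* The two ranges are enlarged one at a time, the inner first, with the constraint moved into the
   summand so that [sum_natmx] applies. *)
transitivity (\sum_(j : 'cV['I_(mi_deg i).+1]_n) \sum_(k : 'cV['I_D.+1]_n)
    if natmx j + natmx k == i then f (natmx j) * g (natmx k) else 0).
  apply: eq_bigr => j _; rewrite big_mkcond.
  apply: (sum_natmx
    (F := fun k => if natmx j + k == i then _ * g k else 0)) => // k.
  case: (natmx j + k =P i) => [jk _ | _ /eqP //].
  by apply: (bnd _ (natmx j)); rewrite addrC.
rewrite (sum_natmx (F := fun j => \sum_(k : 'cV['I_D.+1]_n)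
   if j + natmx k == i then f j * g (natmx k) else 0) le_iD).
  by apply: eq_bigr => j _; rewrite -big_mkcond.
move=> j nz.
case: (pickP (fun k : 'cV['I_D.+1]_n => j + natmx k == i)) =>
  [k /eqP /bnd // | none].
by rewrite big1 ?eqxx // in nz => k _; rewrite none.
Qed.

(** Induction on [l]: the left factor supplies the first entry of the tuple, the remaining power its
    tail. *)
Lemma mfps_exp_tuple (K : numFieldType) n (s : mfps K n) l i D :
  (mi_deg i <= D)%N ->
  mfps_exp s l i =
    \sum_(t : l.-tuple 'cV['I_D.+1]_n | \sum_(c <- t) natmx c == i)
      \prod_(c <- t) s (natmx c).
Proof.
elim: l i => [|l IHl] i le_iD.
  rewrite big_mkcond (big_pred1 [tuple]) => [|t]; last
    by apply/esym/eqP; exact: tuple0.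
  by rewrite !big_nil eq_sym /mfps_exp /= /mfps_one; case: eqP.
rewrite /mfps_exp iterS -/(mfps_exp s l) (mfps_mul_bound _ _ le_iD).
rewrite (sum_tupleS l (fun t => \sum_(c <- t) natmx c == i)
  (fun t => \prod_(c <- t) s (natmx c))).
apply: eq_bigr => j _.
have bnd k : natmx j + k = i -> (mi_deg k <= D)%N.
  by move=> jk; rewrite (leq_trans _ le_iD) // -jk mi_degD leq_addl.
(* Tails are grouped by their sum [k]; it is at most [i] entrywise, hence representable below the
   bound [D]. *)
rewrite [RHS](partition_big
    (fun t : l.-tuple _ => map_mx (@inord D) (\sum_(c <- t) natmx c))
    (fun k => natmx j + natmx k == i)) /=; last first.
  move=> t; rewrite big_cons => /eqP jt; rewrite natmx_inord ?jt // => r c.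
  by rewrite (leq_trans (mi_deg_ge _ _ _)) // bnd.
apply: eq_bigr => k /eqP jk; rewrite IHl ?bnd // big_distrr /=.
apply: eq_big => [t | t _]; last by rewrite big_cons.
rewrite big_cons; apply/eqP/andP => [tk | [/eqP jt /eqP <-]].
  rewrite tk jk eqxx; split => //; apply/eqP/natmx_inj/natmx_inord => r c.
  by rewrite mxE -ltnS.
by rewrite natmx_inord // => r c; rewrite (leq_trans (mi_deg_ge _ _ _)) // bnd.
Qed.

(** * Partitions as sorted tuples of columns *)

Lemma lexcol_total n : total (@lexcol n).
Proof. by move=> u v; apply: Order.TotalTheory.le_total. Qed.

Lemma lexcol_trans n : transitive (@lexcol n).
Proof. by move=> v u w; apply: Order.POrderTheory.le_trans. Qed.

Lemma lexcol_anti n : antisymmetric (@lexcol n).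
Proof.
move=> u v /Order.POrderTheory.le_anti /eq_in_map eq_uv.
by apply/matrixP => r k; rewrite ord1 eq_uv // mem_enum.
Qed.

Definition col_tuple (T : Type) n l (M : 'M[T]_(n, l)) : l.-tuple 'cV[T]_n :=
  [tuple col j M | j < l].

Lemma col_tuple_bij (T : Type) n l : bijective (@col_tuple T n l).
Proof.
exists (fun t : l.-tuple 'cV[T]_n => \matrix_(r, j) tnth t j r ord0) => [M | t].
  by apply/matrixP => r j; rewrite !mxE tnth_mktuple mxE.
apply: eq_from_tnth => j; rewrite tnth_mktuple.
by apply/matrixP => r k; rewrite !mxE (ord1 k).
Qed.

Lemma columns_natmx d n l (M : 'M['I_d]_(n, l)) :
  columns (natmx M) = [seq natmx c | c <- col_tuple M].
Proof.
rewrite /columns /= -map_comp; apply: eq_map => j /=.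
by apply/matrixP => r k; rewrite !mxE.
Qed.

(** Agreement away from 0 suffices because a partition has no zero column. So [h] can be the plain
    weight g_c / c!, whatever its value at 0. *)
Lemma mfps_exp_mpart (K : numFieldType) n (s h : mfps K n) l i d :
    s 0 = 0 -> (forall c, c != 0 -> s c = h c) -> (mi_deg i <= d)%N ->
  mfps_exp s l i / (l`!)%:R =
    \sum_(L : 'M['I_d.+1]_(n, l) | is_mpartition i (natmx L))
      (\prod_(c <- columns (natmx L)) h c) / (mult_fact (natmx L))%:R.
Proof.
move=> s0 sh le_id; rewrite (mfps_exp_tuple _ _ le_id).
pose leT (u v : 'cV['I_d.+1]_n) := lexcol (natmx u) (natmx v).
have leT_total : total leT by move=> u v; apply: lexcol_total.
have leT_trans : transitive leT by move=> u v w; apply: lexcol_trans.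
have leT_anti : antisymmetric leT by move=> u v /lexcol_anti /natmx_inj.
have perm_sum (t u : seq 'cV['I_d.+1]_n) : perm_eq t u ->
    (\sum_(c <- t) natmx c == i) = (\sum_(c <- u) natmx c == i).
  by move=> tu; rewrite (perm_big _ tu).
have perm_prod (t u : seq 'cV['I_d.+1]_n) : perm_eq t u ->
    \prod_(c <- t) s (natmx c) = \prod_(c <- u) s (natmx c).
  by move=> tu; rewrite (perm_big _ tu).
rewrite (@sum_sorted_tuple _ _ leT l (fun t => \sum_(c <- t) natmx c == i)
  (fun t => \prod_(c <- t) s (natmx c))) //.
(* Tuples are read as the columns of a matrix, so that both sides can be compared term by term. *)
rewrite big_distrl /= (reindex (@col_tuple _ n l)); last first.
  exact/onW_bij/col_tuple_bij.
rewrite big_mkcond [RHS]big_mkcond; apply: eq_bigr => L _.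
set t := col_tuple L.
have colE j : col j (natmx L) = natmx (tnth t j).
  by apply/matrixP => r k; rewrite tnth_mktuple !mxE.
have sum_t : (\sum_(c <- t) natmx c == i) =
    [forall r, (\sum_(j < l) natmx L r j)%N == i r ord0].
  have E r : (\sum_(c <- t) natmx c) r ord0 = (\sum_(j < l) natmx L r j)%N.
    rewrite big_tuple summxE; apply: eq_bigr => j _.
    by rewrite -colE mxE.
  apply/eqP/forallP => [<- r | rs]; first by rewrite E.
  by apply/matrixP => r k; rewrite ord1 E; exact/eqP.
rewrite /is_mpartition columns_natmx -/t sorted_map -/leT -sum_t.
(* A zero column puts the factor [s 0 = 0] into the product, which matches its exclusion from
   [is_mpartition]. *)
have [nz | /forallPn[j /negPn/eqP z]] :=
  boolP [forall j, col j (natmx L) != 0]; last first.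
  have -> : \prod_(c <- t) s (natmx c) = 0.
    by rewrite big_tuple (bigD1 j) //= -colE z s0 mul0r.
  by rewrite mul0rn mul0r if_same.
case: ifP => // _.
have t0 c : c \in (t : seq _) -> natmx c != 0.
  by move=> /tnthP[j ->]; rewrite -colE; exact: (forallP nz).
rewrite big_map (eq_big_seq (fun c => h (natmx c))); last by move=> c /t0 /sh.
have -> : mult_fact (natmx L) = (\prod_(c <- undup t) (count_mem c t)`!)%N.
  rewrite /mult_fact columns_natmx (undup_map_inj (@natmx_inj _ _ _)) big_map.
  apply: eq_bigr => c _; rewrite count_map; congr (_`!).
  by apply: eq_count => u /=; rewrite (inj_eq (@natmx_inj _ _ _)).
(* With l! written as the number of rearrangements times [m], that number cancels; it divides l!, so
   it is nonzero in [K]. *)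
have := size_permutations_multinomial t; rewrite size_tuple => <-.
set P := \prod_(c <- t) _; set m := (\prod_(c <- _) _)%N.
have sz0 : (size (permutations t))%:R != 0 :> K.
  have := fact_gt0 l; rewrite -{1}(size_tuple t) -size_permutations_multinomial.
  by rewrite muln_gt0 pnatr_eq0 -lt0n => /andP[].
by rewrite /= -[P *+ _]mulr_natr natrM invfM mulrA mulfK.
Qed.

Theorem theorem3p1 (F : realType) (K : numFieldType)
    (hK : real_or_complex F K) (A : choiceType)
    (E : {scalar umbral_poly K A}) (hE : umbral_evaluation E)
    (alpha : A) (n : nat) (mu : n.-tuple {cmonom A}) :
  gf_aux E alpha mu =1
    gf_subst E alpha (mfps_sub (gf E mu) (mfps_one K n)).
Proof.
move=> i; set s := mfps_sub _ _; set g := mmoment E mu.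
have s0 : s 0 = 0 by rewrite /s /mfps_sub /gf /mfps_egf /mfps_one eqxx subrr.
have sh c : c != 0 -> s c = g c / (mi_fact c)%:R.
  by move=> /negPf nz; rewrite /s /mfps_sub /gf /mfps_egf /mfps_one nz subr0.
rewrite /gf_aux /gf_subst /mfps_egf /egf_subst /mfps_one.
have [-> | nz] := eqVneq i 0.
  rewrite [mi_deg 0]big1 ?big_geq ?addr0 // => r _; exact: mxE.
(* The term k = 0 may be added: the zeroth power is the series 1, whose coefficient at [i != 0]
   vanishes. *)
rewrite add0r; transitivity (\sum_(0 <= k < (mi_deg i).+1)
    moment E alpha k * mfps_exp s k i / (k`!)%:R); last first.
  by rewrite big_ltn // /mfps_exp /= /mfps_one (negPf nz) mulr0 mul0r add0r.
rewrite big_mkord /aux_moment /mpart_sum big_distrl; apply: eq_bigr => l _ /=.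
rewrite -mulrA (mfps_exp_mpart _ s0 sh (leqnn _)) big_distrl big_distrr /=.
apply: eq_bigr => L _.
(* Grouping equal columns turns the product of weights into g_lambda / lambda!. *)
have -> : (\prod_(c <- columns (natmx L)) (g c / (mi_fact c)%:R)) =
   mpart_prod g (natmx L) / (mpart_fact (natmx L))%:R.
  rewrite big_split /= prodfV; congr (_ / _).
    by rewrite /mpart_prod prodr_undup_exp_count.
  rewrite /mpart_fact -prodr_undup_exp_count natr_prod.
  by apply: eq_bigr => c _; rewrite natrX.
rewrite invfM.
have x0 : (mi_fact i)%:R != 0 :> K.
  by rewrite pnatr_eq0 -lt0n; apply: prodn_gt0 => r; apply: fact_gt0.
by apply: (mulIf x0); rewrite mulfVK // -/g; ring.
Qed.
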